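(* For every $r_0,C_0>0$ there exists $A_*=A_*(r_0,C_0)>0$ such that, for every $A\geq A_*$, there are constants $c=c(r_0,C_0,A)>0$ and $n_0=n_0(r_0,C_0,A)\in\mathbb{N}$ with the following property. Let $n\geq n_0$, let $1\leq v\leq\sqrt n$, and let $Q\subset\mathbb{R}^n$ be an origin-symmetric convex body satisfying \[ r_0\sqrt n\,B_2^n\subset Q,\qquad |Q|^{1/n}\leq C_0v . \] Set $U=Av\sqrt n\,B_2^n$. Then there exists an even continuous probability density $h$ on $\mathbb{R}^n$ such that \[ \operatorname{supp}h\subset U\setminus\operatorname{int}\left(\left(1+\frac1n\right)Q\right) \] and \[ \int_{\xi^\perp}h(x)\,d\lambda_{\xi^\perp}(x)\geq\frac{c}{v}\qquad\text{for every }\xi\in\mathbb{S}^{n-1}. \]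
   Context: A convex body is a compact convex set with nonempty interior. $B_2^n$ is the Euclidean unit ball of $\mathbb{R}^n$, $\mathbb{S}^{n-1}$ its boundary sphere, $|A|$ is Lebesgue measure of $A$, $\xi^\perp=\{x\in\mathbb{R}^n:\langle x,\xi\rangle=0\}$, and $\lambda_{\xi^\perp}$ is $(n-1)$-dimensional Lebesgue measure on $\xi^\perp$. $\operatorname{supp}h$ is the closure of $\{x:h(x)\ne0\}$. A probability density is a nonnegative function on $\mathbb{R}^n$ with Lebesgue integral $1$. *)

(* Defs.v *)
From HB Require Import structures.
From mathcomp Require Import all_boot all_order all_algebra.
From mathcomp Require Import all_classical all_reals all_analysis.
From mathcomp Require Import measurable_realfun ring.

Set Implicit Arguments.
Unset Strict Implicit.
Unset Printing Implicit Defensive.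

Import Order.TTheory GRing.Theory Num.Theory.
Import numFieldNormedType.Exports.

Local Open Scope classical_set_scope.
Local Open Scope ring_scope.

Definition rV_display : measure_display. Proof. exact: default_measure_display. Qed.

(* The Borel sets of R^n, as the product sigma-algebra: the one generated by the
   coordinate maps. *)
Section rV_measurable.
Context (R : realType) (n : nat).

Let coord (i : 'I_n) (x : 'rV[R]_n) : measurableTypeR R := x ord0 i.

Let rV_set0 : g_sigma_preimage coord set0.
Proof. exact: sigma_algebra0. Qed.

Let rV_setC A : g_sigma_preimage coord A -> g_sigma_preimage coord (~` A).
Proof. exact: sigma_algebraC. Qed.

Let rV_bigcup (F : (set 'rV[R]_n)^nat) : (forall i, g_sigma_preimage coord (F i)) ->
  g_sigma_preimage coord (\bigcup_i (F i)).
Proof. exact: sigma_algebra_bigcup. Qed.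

HB.instance Definition _ := @isMeasurable.Build rV_display
  'rV[R]_n (g_sigma_preimage coord) rV_set0 rV_setC rV_bigcup.

Lemma measurable_rV_coord (i : 'I_n) :
  measurable_fun [set: 'rV[R]_n] (fun x => x ord0 i : measurableTypeR R).
Proof.
move=> _ Y mY; rewrite setTI; apply: sub_sigma_algebra => /=.
rewrite -bigcup_seq/=; exists i => /=; first by rewrite mem_index_enum.
by exists Y => //; rewrite setTI.
Qed.

Lemma measurable_fun_rV d (T : measurableType d) (f : T -> 'rV[R]_n) :
  (forall i, measurable_fun [set: T] (fun t => f t ord0 i : measurableTypeR R)) ->
  measurable_fun [set: T] f.
Proof.
move=> mf.
have H : g_sigma_preimage coord `<=` [set A | measurable (f @^-1` A)].
  apply: smallest_sub.
    split => [|A|F]; rewrite /=.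
    - by rewrite preimage_set0.
    - by rewrite setTD preimage_setC => mA; exact: measurableC.
    - by move=> mF; rewrite preimage_bigcup; exact: bigcup_measurable.
  rewrite -bigcup_seq; apply: bigcup_sub => i _ A [B mB <-] /=.
  have := mf i measurableT B mB; rewrite !setTI.
  by congr measurable.
by move=> _ Y mY; rewrite setTI; exact: H.
Qed.

Lemma measurable_rV_box (A : 'I_n -> set (measurableTypeR R)) :
  (forall i, measurable (A i)) ->
  measurable [set x : 'rV[R]_n | forall i, A i (x ord0 i)].
Proof.
move=> mA; rewrite (_ : mkset _ =
    \bigcap_(i in [set: 'I_n]) ((fun x : 'rV[R]_n => x ord0 i) @^-1` A i)).
  apply: fin_bigcap_measurable => // i _; rewrite -[X in measurable X]setTI.
  exact: measurable_rV_coord.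
by apply/seteqP; split=> x /= Ax i; [move=> _; exact: Ax|exact: (Ax i I)].
Qed.

End rV_measurable.


Section rV_cons.
Context (R : realType) (n : nat).
Implicit Types p : measurableTypeR R * 'rV[R]_n.

Definition rV_cons p : 'rV[R]_n.+1 := row_mx (p.1)%:M p.2.

Lemma rV_cons0 p : rV_cons p ord0 ord0 = p.1.
Proof.
by have := row_mxEl (p.1)%:M p.2 ord0 ord0; rewrite [RHS]mxE mulr1n lshift0.
Qed.

Lemma rV_consS p i : rV_cons p ord0 (lift ord0 i) = p.2 ord0 i.
Proof. by have := row_mxEr (p.1)%:M p.2 ord0 i; rewrite rshift1. Qed.

Lemma rV_cons_tl p : \row_i rV_cons p ord0 (lift ord0 i) = p.2.
Proof. by apply/rowP => i; rewrite mxE rV_consS. Qed.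

Lemma measurable_rV_cons : measurable_fun [set: _] rV_cons.
Proof.
apply: measurable_fun_rV => i; case: (unliftP ord0 i) => [j ->|->].
- under eq_fun do rewrite rV_consS.
  exact: (measurableT_comp (@measurable_rV_coord R n j) measurable_snd).
- under eq_fun do rewrite rV_cons0.
  exact: measurable_fst.
Qed.

HB.instance Definition _ := isMeasurableFun.Build _ _ _ _ rV_cons
  measurable_rV_cons.

End rV_cons.

Section lebesgue_rV_cons.
Local Open Scope ereal_scope.
Context (R : realType) (n : nat).
Context (mu : {sigma_finite_measure set 'rV[R]_n -> \bar R}).

Definition lebesgue_rV_cons : set 'rV[R]_n.+1 -> \bar R :=
  pushforward (@lebesgue_measure R \x mu) (@rV_cons R n).

Let m0 : lebesgue_rV_cons set0 = 0.
Proof. exact: measure0. Qed.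

Let m_ge0 A : 0 <= lebesgue_rV_cons A.
Proof. exact: measure_ge0. Qed.

Let m_sigma_additive : semi_sigma_additive lebesgue_rV_cons.
Proof.
exact: (@measure_semi_sigma_additive _ _ _
  (pushforward (@lebesgue_measure R \x mu) (@rV_cons R n))).
Qed.

HB.instance Definition _ := isMeasure.Build _ _ _ lebesgue_rV_cons
  m0 m_ge0 m_sigma_additive.

Lemma lebesgue_rV_consE (A : set (measurableTypeR R)) (B : set 'rV[R]_n) :
  measurable A -> measurable B ->
  lebesgue_rV_cons [set x | A (x ord0 ord0) /\ B (\row_i x ord0 (lift ord0 i))]
  = lebesgue_measure A * mu B.
Proof.
move=> mA mB; rewrite -product_measure1E// /lebesgue_rV_cons /pushforward.
congr (_ _); apply/seteqP.
by split => p /=; rewrite rV_cons0 rV_cons_tl.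
Qed.

Let m_sigma_finite : sigma_finite setT lebesgue_rV_cons.
Proof.
have /sigma_finiteP[F [TF ndF Foo]] := sigma_finiteT (@lebesgue_measure R).
have /sigma_finiteP[G [TG ndG Goo]] := sigma_finiteT mu.
exists (fun k => [set x : 'rV[R]_n.+1 |
    F k (x ord0 ord0) /\ G k (\row_i x ord0 (lift ord0 i))]).
  apply/esym; rewrite -subTset => x _.
  have [i _ Fi] : (\bigcup_k F k) (x ord0 ord0) by rewrite -TF.
  have [j _ Gj] : (\bigcup_k G k) (\row_i x ord0 (lift ord0 i)) by rewrite -TG.
  exists (maxn i j) => //; split.
  - by move: Fi; apply/subsetPset/ndF; rewrite leq_maxl.
  - by move: Gj; apply/subsetPset/ndG; rewrite leq_maxr.
move=> k; have [mF Fk] := Foo k; have [mG Gk] := Goo k; split; last first.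
  by rewrite lebesgue_rV_consE// lte_mul_pinfty// ge0_fin_numE.
apply: measurableI; rewrite -[X in measurable X]setTI.
  exact: (@measurable_rV_coord R _ ord0).
suff : measurable_fun [set: 'rV[R]_n.+1]
    (fun x => \row_(i < n) x ord0 (lift ord0 i)) by exact.
apply: measurable_fun_rV => i; under eq_fun do rewrite mxE.
exact: measurable_rV_coord.
Qed.

HB.instance Definition _ := Measure_isSigmaFinite.Build _ _ _ lebesgue_rV_cons
  m_sigma_finite.

End lebesgue_rV_cons.

Section lebesgue_rV.
Local Open Scope ereal_scope.
Context (R : realType).

Fixpoint lebesgue_rV (n : nat) : {sigma_finite_measure set 'rV[R]_n -> \bar R} :=
  match n with
  | 0%N => \d_(0%R : 'rV[R]_0)
  | m.+1 => lebesgue_rV_cons (lebesgue_rV m)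
  end.

Lemma lebesgue_rV_box n (A : 'I_n -> set (measurableTypeR R)) :
  (forall i, measurable (A i)) ->
  lebesgue_rV n [set x | forall i, A i (x ord0 i)]
  = \prod_(i < n) lebesgue_measure (A i).
Proof.
elim: n A => [|n IH] A mA.
  by rewrite big_ord0 /= diracE mem_set//= => -[].
rewrite big_ord_recl -(IH (fun i => A (lift ord0 i)))// -lebesgue_rV_consE//.
  rewrite [LHS]/=; congr (lebesgue_rV_cons _ _); apply/seteqP; split=> x /= Ax.
    by split=> [|i]; rewrite ?mxE; exact: Ax.
  case: Ax => A0 AS i; case: (unliftP ord0 i) => [j ->|-> //].
  by have := AS j; rewrite mxE.
exact: (measurable_rV_box (fun i => mA (lift ord0 i))).
Qed.

End lebesgue_rV.

Section euclidean.
Context (R : realType) (n : nat).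
Implicit Types (x y xi : 'rV[R]_n) (A Q : set 'rV[R]_n) (h : 'rV[R]_n -> R).

Definition dot x y : R := \sum_(i < n) x ord0 i * y ord0 i.

Lemma mulmx_tr x y : x *m y^T = (dot x y)%:M.
Proof.
rewrite [LHS]mx11_scalar mxE; congr (_%:M); apply: eq_bigr => i _.
by rewrite !mxE.
Qed.

(* The library norm `|x| of a row vector is the sup norm. *)
Definition l2norm x : R := Num.sqrt (dot x x).

Lemma l2norm1_dot x : l2norm x = 1 -> dot x x = 1.
Proof.
rewrite /l2norm => /(congr1 (fun t => t ^+ 2)).
by rewrite sqr_sqrtr ?expr1n// sumr_ge0// => i _; rewrite -expr2 sqr_ge0.
Qed.

Definition l2ball : set 'rV[R]_n := [set x | l2norm x <= 1].

Definition dilate (r : R) A : set 'rV[R]_n := [set r *: x | x in A].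

Definition convex_body Q := [/\ compact Q, convex_set Q & Q° !=set0].

Definition origin_symmetric Q := forall x, Q x -> Q (- x).

Definition even_fun h := forall x, h (- x) = h x.

Definition supp h : set 'rV[R]_n := closure [set x | h x != 0].

Definition probability_density h :=
  (forall x, 0 <= h x) /\ (\int[@lebesgue_rV R n]_x (h x)%:E = 1)%E.

Definition perp xi : set 'rV[R]_n := [set x | dot x xi = 0].

End euclidean.

(* The rows of B form an orthonormal basis of the hyperplane orthogonal to xi. *)
Definition perp_frame (R : realType) (n : nat) (xi : 'rV[R]_n) (B : 'M[R]_(n.-1, n)) :=
  B *m B^T = 1%:M /\ B *m xi^T = 0.

Lemma perp_frame_exists (R : realType) (n : nat) (xi : 'rV[R]_n) :
  l2norm xi = 1 -> exists B, perp_frame xi B.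
Proof.
case: n xi => [|m] xi xi1.
  by exists 0; split; apply/matrixP => -[].
pose e : 'rV[R]_m.+1 := delta_mx ord0 ord0.
pose v := xi - e.
(* Householder reflection exchanging e and xi *)
pose q := dot v v.
pose c := 2 / q.
pose H : 'M[R]_m.+1 := 1%:M - c *: (v^T *m v).
have xixi := l2norm1_dot xi1.
have dotev : dot e v = xi ord0 ord0 - 1.
  rewrite /dot (bigD1 ord0)//= big1 ?addr0; first by rewrite !mxE !eqxx mul1r.
  by move=> i i0; rewrite !mxE (negbTE i0) mul0r.
have qE : q = 2 - 2 * xi ord0 ord0.
  transitivity (dot xi xi - 2 * dot e xi + dot e e).
    rewrite /q /dot mulr_sumr -sumrN -!big_split/=; apply: eq_bigr => i _.
    by rewrite !mxE; ring.
  rewrite xixi.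
  have -> : dot e xi = xi ord0 ord0.
    rewrite /dot (bigD1 ord0)//= big1 ?addr0; first by rewrite !mxE !eqxx mul1r.
    by move=> i i0; rewrite !mxE (negbTE i0) mul0r.
  have -> : dot e e = 1.
    rewrite /dot (bigD1 ord0)//= big1 ?addr0; first by rewrite !mxE !eqxx mul1r.
    by move=> i i0; rewrite !mxE (negbTE i0) mul0r.
  by ring.
have v0 : q = 0 -> v = 0.
  move=> q0; apply/rowP => i; rewrite [RHS]mxE; apply/eqP.
  rewrite -sqrf_eq0 expr2; move: q0 => /eqP; rewrite /q /dot psumr_eq0.
    by move=> /allP/(_ i); rewrite mem_index_enum => /(_ isT).
  by move=> j _; rewrite -expr2 sqr_ge0.
have HT : H^T = H.
  by rewrite /H linearB/= linearZ/= trmx_mul trmxK trmx1.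
have HH : H *m H^T = 1%:M.
  rewrite HT /H.
  have : c ^+ 2 * q = c * 2 \/ v^T *m v = 0.
    have [/v0 ->|q0] := eqVneq q 0; first by right; rewrite trmx0 mul0mx.
    by left; rewrite expr2 -mulrA /c divfK.
  have : (v^T *m v) *m (v^T *m v) = q *: (v^T *m v).
    by rewrite mulmxA -(mulmxA v^T) mulmx_tr scalar_mxC -mulmxA mul_scalar_mx.
  move: (v^T *m v) => P PP [cq|->]; last by rewrite scaler0 subr0 mul1mx.
  rewrite mulmxBl mul1mx mulmxBr mulmx1 -scalemxAl -scalemxAr PP !scalerA.
  rewrite -expr2 cq mulr_natr mulr2n scalerDl.
  by rewrite opprB addrK subrK.
have eH : e *m H = xi.
  rewrite /H mulmxBr mulmx1 -scalemxAr mulmxA mulmx_tr mul_scalar_mx scalerA dotev.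
  have [/v0 vE|q0] := eqVneq q 0.
    by rewrite vE scaler0 subr0; apply/esym/eqP; rewrite -subr_eq0 -/v vE.
  have -> : c * (xi ord0 ord0 - 1) = -1.
    by apply: (mulIf q0); rewrite mulrAC /c divfK// qE; ring.
  by rewrite scaleN1r opprK addrC subrK.
have HHE (i j : 'I_m.+1) : \sum_k H i k * H j k = (i == j)%:R :> R.
  have -> : (i == j)%:R = (H *m H^T) i j by rewrite HH [RHS]mxE.
  by rewrite mxE; apply: eq_bigr => k _; congr (_ * _); rewrite [RHS]mxE.
exists (rowsub (lift ord0) H : 'M[R]_(m, m.+1)); split; apply/matrixP => i j.
  rewrite [RHS]mxE -(inj_eq (@lift_inj _ ord0)) -HHE mxE.
  by apply: eq_bigr => k _; rewrite !mxE.
rewrite [RHS]mxE -[RHS](HHE (lift ord0 i) ord0) mxE.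
apply: eq_bigr => k _; rewrite [X in X * _]mxE [X in _ * X]mxE; congr (_ * _).
rewrite ord1 -eH mxE (bigD1 ord0)//= big1 ?addr0.
  by rewrite mxE !eqxx mul1r.
by move=> l l0; rewrite mxE (negbTE l0) mul0r.
Qed.

Section lebesgue_perp.
Local Open Scope ereal_scope.
Context (R : realType) (n : nat).

Lemma measurable_mulmx_rV m (B : 'M[R]_(m, n)) :
  measurable_fun [set: 'rV[R]_m] (mulmx^~ B : 'rV[R]_m -> 'rV[R]_n).
Proof.
apply: measurable_fun_rV => i; under eq_fun do rewrite mxE.
apply: measurable_sum => j; apply: measurable_funM => //.
exact: measurable_rV_coord.
Qed.

(* Some orthonormal frame of the hyperplane; when n > 0, one exists for every
   unit vector xi by perp_frame_exists. *)
Definition some_perp_frame (xi : 'rV[R]_n) : 'M[R]_(n.-1, n) :=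
  xget 0%R [set B | perp_frame xi B].

Lemma some_perp_frameP (xi : 'rV[R]_n) :
  l2norm xi = 1%R -> perp_frame xi (some_perp_frame xi).
Proof. by move=> /perp_frame_exists; exact: xgetPex. Qed.

Definition perp_embedding (xi : 'rV[R]_n) (y : 'rV[R]_n.-1) : 'rV[R]_n :=
  y *m some_perp_frame xi.

Lemma range_perp_embedding (xi : 'rV[R]_n) :
  l2norm xi = 1%R -> range (perp_embedding xi) = perp xi.
Proof.
move=> xi1; have := some_perp_frameP xi1; rewrite /perp_embedding.
case: n xi xi1 (some_perp_frame xi) => [|m] xi xi1 B [BB Bxi].
  have : l2norm xi = 0%R by rewrite /l2norm /dot big_ord0 sqrtr0.
  by rewrite xi1 => /eqP; rewrite oner_eq0.
have xixi := l2norm1_dot xi1.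
have xiB : xi *m B^T = 0%R by rewrite -[xi]trmxK -trmx_mul Bxi trmx0.
have MM : col_mx xi B *m (col_mx xi B)^T = 1%:M.
  by rewrite tr_col_mx mul_col_row mulmx_tr xixi xiB Bxi BB -scalar_mx_block.
have MTM : (xi^T *m xi + B^T *m B)%R = 1%:M.
  by have := mulmx1C MM; rewrite tr_col_mx mul_row_col.
apply/seteqP; split=> [_ [y _ <-]|x xix].
  have /matrixP/(_ ord0 ord0) : (y *m B) *m xi^T = 0%R.
    by rewrite -mulmxA Bxi mulmx0.
  by rewrite mulmx_tr !mxE eqxx mulr1n.
exists (x *m B^T) => //; rewrite -mulmxA.
rewrite -[RHS]mulmx1 -MTM mulmxDr (mulmxA x xi^T) mulmx_tr xix.
by rewrite mul_scalar_mx scale0r add0r.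
Qed.

HB.instance Definition _ xi := isMeasurableFun.Build _ _ _ _
  (perp_embedding xi) (@measurable_mulmx_rV _ (some_perp_frame xi)).

(* (n-1)-dimensional Lebesgue measure on the hyperplane orthogonal to xi, as a
   measure on R^n carried by that hyperplane: the image of Lebesgue measure on
   R^(n-1) under the isometry perp_embedding xi. It does not depend on the chosen
   frame, since Lebesgue measure is rotation invariant. *)
Definition lebesgue_perp (xi : 'rV[R]_n) : set 'rV[R]_n -> \bar R :=
  pushforward (lebesgue_rV R n.-1) (perp_embedding xi).

Section lebesgue_perp_measure.
Context (xi : 'rV[R]_n).

Let m0 : lebesgue_perp xi set0 = 0.
Proof. exact: measure0. Qed.

Let m_ge0 A : 0 <= lebesgue_perp xi A.
Proof. exact: measure_ge0. Qed.

Let m_sigma_additive : semi_sigma_additive (lebesgue_perp xi).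
Proof.
exact: (@measure_semi_sigma_additive _ _ _
  (pushforward (lebesgue_rV R n.-1) (perp_embedding xi))).
Qed.

HB.instance Definition _ := isMeasure.Build _ _ _ (lebesgue_perp xi)
  m0 m_ge0 m_sigma_additive.

End lebesgue_perp_measure.
End lebesgue_perp.

(* Main.v *)
(* Take h proportional to a Gaussian of width about A v, cut off outside U and on
   (1 + 1/n) Q. The restriction of the Gaussian to any hyperplane through 0 is the
   same Gaussian in dimension n - 1, so its mass there is g^(n-1) against a total
   mass g^n, where g is of order A v: the ratio 1/g is the desired c/v. It remains
   to see that the cutoffs lose at most half of the mass, both in R^n and in every
   hyperplane. The tail beyond radius A v sqrt(n/2) is exponentially small compared
   with the whole. Outside 3 Q nothing is lost to the other cutoff, and 3 Q has
   volume at most (3 C0 v)^n, which is much smaller than g^n once A is large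
   compared with C0. A section of 3 Q cannot be large either: Q contains a ball of
   radius r0 sqrt n, so by convexity 6 Q contains the product of this section with
   a segment orthogonal to it, and v <= sqrt n absorbs the length of the segment.
   The only facts needed about Lebesgue measure are its invariance under rotations
   and its scaling under homotheties, both obtained from Haar uniqueness. *)
Require Import Defs.
From HB Require Import structures.
From mathcomp Require Import all_boot all_order all_algebra.
From mathcomp Require Import all_classical all_reals all_analysis.
From mathcomp Require Import measurable_realfun ring lra.

Set Implicit Arguments.
Unset Strict Implicit.
Unset Printing Implicit Defensive.

Import Order.TTheory GRing.Theory Num.Theory.
Import numFieldNormedType.Exports.

Local Open Scope classical_set_scope.
Local Open Scope ring_scope.

(** * Borel sets of row vectors *)

Section borel.
Context (R : realType) (n : nat).

(** The measurable sets are generated by the coordinates, not by the open sets. An open set is the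
    union of the boxes with rational corners that it contains, and there are countably many of
    these. *)
Lemma open_measurable_rV (O : set 'rV[R]_n) : open O -> measurable O.
Proof.
move=> oO.
pose box (p : 'rV[rat]_n * 'rV[rat]_n) : set 'rV[R]_n :=
  [set x | forall i, `]ratr (p.1 ord0 i), ratr (p.2 ord0 i)[%classic (x ord0 i)].
(* Boxes not inside [O] are replaced by the empty set, so that the union runs over a whole countable
   type. *)
pose F p := if `[< box p `<=` O >] then box p else set0.
rewrite (_ : O = \bigcup_p F p).
  apply: countable_bigcupT_measurable => // p; rewrite /F; case: ifP => // _.
  apply: (measurable_rV_box (A := fun i : 'I_n =>
    `]ratr (p.1 ord0 i), ratr (p.2 ord0 i)[%classic)) => i.
  exact: measurable_itv.
apply/seteqP; split=> [x Ox|x [p _]]; last first.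
  by rewrite /F; case: ifPn => // /asboolP; exact.
have /nbhs_ballP[e /= e0 xeO] : nbhs x O by exact: open_nbhs_nbhs.
have lo (i : 'I_n) : {q : rat | x ord0 i - e < ratr q < x ord0 i}.
  apply: cid; have [q] := @rat_in_itvoo R (x ord0 i - e) (x ord0 i)
    ltac:(by rewrite ltrBlDr ltrDl).
  by rewrite in_itv /=; exists q.
have hi (i : 'I_n) : {q : rat | x ord0 i < ratr q < x ord0 i + e}.
  apply: cid; have [q] := @rat_in_itvoo R (x ord0 i) (x ord0 i + e)
    ltac:(by rewrite ltrDl).
  by rewrite in_itv /=; exists q.
pose p := (\row_i sval (lo i), \row_i sval (hi i)).
have px : box p x.
  move=> i /=; rewrite in_itv /= !mxE.
  by case: (lo i) => q /= /andP[_ ->]; case: (hi i) => q' /= /andP[-> _].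
have pO : box p `<=` O.
  move=> y py; apply: xeO; split => // i j; rewrite ord1.
  have := py j; rewrite /= in_itv /= !mxE /ball /= ltr_norml.
  case: (lo j) => q /= /andP[q1 q2]; case: (hi j) => q' /= /andP[q3 q4].
  by move=> /andP[q5 q6]; apply/andP; split; lra.
by exists p => //; rewrite /F asboolT.
Qed.

Lemma closed_measurable_rV (C : set 'rV[R]_n) : closed C -> measurable C.
Proof.
by move=> /closed_openC /open_measurable_rV /measurableC; rewrite setCK.
Qed.

Lemma continuous_measurable_rV (f : 'rV[R]_n -> R) :
  continuous f -> measurable_fun [set: 'rV[R]_n] (f : _ -> measurableTypeR R).
Proof.
move=> cf; apply: (measurability _ (RGenOpens.measurableE R)).
move=> _ [A oA <-]; rewrite setTI; apply: open_measurable_rV.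
move/continuousP : cf; apply; case: oA => a [b ->]; exact: interval_open.
Qed.

End borel.

(** * Translations and Haar uniqueness *)

Section translation.
Local Open Scope ereal_scope.
Context (R : realType).

Definition shift (a : R) (x : measurableTypeR R) : measurableTypeR R := (x + a)%R.

Lemma measurable_shift a : measurable_fun [set: measurableTypeR R] (shift a).
Proof. exact: measurable_funD. Qed.

HB.instance Definition _ a := isMeasurableFun.Build _ _ _ _ (shift a)
  (measurable_shift a).

(** A shifted half-open interval keeps its length, and the values on such intervals determine
    Lebesgue measure. *)
Lemma lebesgue_measure_shift (a : R) (A : set (measurableTypeR R)) : measurable A ->
  pushforward lebesgue_measure (shift a) A = lebesgue_measure A.
Proof.
move=> mA; apply/esym/lebesgue_measure_unique => //= _ [[b c]] _ <-.
rewrite /pushforward (_ : _ @^-1` _ = `](b - a)%R, (c - a)%R]%classic); last first.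
  by apply/seteqP; split=> x /=; rewrite !in_itv/= ltrBlDr lerBrDr.
rewrite !lebesgue_measure_itv/= !lte_fin ltrD2r; case: ifP => // _.
by rewrite -!EFinB; congr EFin; ring.
Qed.

Lemma integral_shift (a : R) (f : measurableTypeR R -> \bar R) :
  measurable_fun [set: measurableTypeR R] f -> (forall x, 0 <= f x) ->
  \int[@lebesgue_measure R]_x f (shift a x) = \int[@lebesgue_measure R]_x f x.
Proof.
move=> mf f0.
rewrite -[LHS](ge0_integral_pushforward (measurable_shift a) _ measurableT)//.
by apply: eq_measure_integral => A mA _; exact: lebesgue_measure_shift.
Qed.

Lemma measurable_rVD d (T : measurableType d) n (f g : T -> 'rV[R]_n) :
  measurable_fun [set: T] f -> measurable_fun [set: T] g ->
  measurable_fun [set: T] (fun t => (f t + g t)%R).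
Proof.
move=> mf mg; apply: measurable_fun_rV => i; under eq_fun do rewrite mxE.
by apply: measurable_funD; apply: (measurableT_comp (@measurable_rV_coord R n i)).
Qed.

Lemma measurable_rVN d (T : measurableType d) n (f : T -> 'rV[R]_n) :
  measurable_fun [set: T] f -> measurable_fun [set: T] (fun t => (- f t)%R).
Proof.
move=> mf; apply: measurable_fun_rV => i; under eq_fun do rewrite mxE.
by apply: measurable_funN; apply: (measurableT_comp (@measurable_rV_coord R n i)).
Qed.

Lemma measurable_preimage d1 d2 (X : measurableType d1) (Y : measurableType d2)
    (f : X -> Y) (A : set Y) :
  measurable_fun [set: X] f -> measurable A -> measurable (f @^-1` A).
Proof. by move=> mf mA; rewrite -[X in measurable X]setTI; exact: mf. Qed.

Lemma lebesgue_rVSE n (A : set 'rV[R]_n.+1) : lebesgue_rV R n.+1 A =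
  \int[@lebesgue_measure R]_t lebesgue_rV R n [set y | A (rV_cons (t, y))].
Proof.
rewrite /= /lebesgue_rV_cons /pushforward /product_measure1.
apply: eq_integral => t _ /=; congr (lebesgue_rV R n _).
by apply/seteqP; split => y /=; rewrite /xsection/= inE.
Qed.

Lemma measurable_fun_lebesgue_rV_cons n (A : set 'rV[R]_n.+1) : measurable A ->
  measurable_fun [set: measurableTypeR R]
    (fun t => lebesgue_rV R n [set y | A (rV_cons (t, y))]).
Proof.
move=> mA; rewrite (_ : (fun _ => _) =
    lebesgue_rV R n \o xsection (@rV_cons R n @^-1` A)); last first.
  apply/funext => t /=; congr (lebesgue_rV R n _).
  by apply/seteqP; split => y /=; rewrite /xsection/= inE.
apply: measurable_fun_xsection; apply: measurable_preimage => //.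
Qed.

(** Induction on the dimension: slice along the first coordinate, shift that coordinate on the line,
    and translate each slice by the induction hypothesis. *)
Lemma lebesgue_rV_translate n (z : 'rV[R]_n) (A : set 'rV[R]_n) :
  measurable A -> lebesgue_rV R n [set x | A (x + z)%R] = lebesgue_rV R n A.
Proof.
elim: n z A => [|n IH] z A mA.
  by congr (lebesgue_rV R 0 _); apply/seteqP; split => x /=;
    rewrite (thinmx0 (x + z)%R) (thinmx0 x).
rewrite !lebesgue_rVSE.
rewrite -[RHS](integral_shift (z ord0 ord0)) //; last first.
  exact: measurable_fun_lebesgue_rV_cons.
apply: eq_integral => t _.
rewrite -[RHS](IH (\row_i z ord0 (lift ord0 i))); last first.
  rewrite -[X in measurable X]/((fun y => rV_cons ((t + z ord0 ord0)%R, y)) @^-1` A).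
  apply: measurable_preimage => //; apply: (measurableT_comp (@measurable_rV_cons R n)).
  exact: pair1_measurable.
have consD y : (rV_cons (t, y) + z = rV_cons (shift (z ord0 ord0) t,
    y + \row_i z ord0 (lift ord0 i)))%R.
  apply/rowP => i; case: (unliftP ord0 i) => [j ->|->]; rewrite [LHS]mxE.
    by rewrite !rV_consS/= !mxE.
  by rewrite !rV_cons0.
by congr (lebesgue_rV R n _); apply/seteqP; split => y /=; rewrite consD.
Qed.

(** Evaluates both double integrals of the Haar argument below, where the fibres over the first
    variable are translates of one fixed set. *)
Lemma lebesgue_prod_fibers n (C : set 'rV[R]_n) (D : 'rV[R]_n -> set 'rV[R]_n) v :
  measurable C -> 0 <= v -> (forall x, lebesgue_rV R n (D x) = v) ->
  (lebesgue_rV R n \x lebesgue_rV R n) [set p | C p.1 /\ D p.1 p.2]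
  = lebesgue_rV R n C * v.
Proof.
move=> mC v0 Dv; rewrite /product_measure1.
rewrite (eq_integral (fun x => (\1_C x)%:E * v)); last first.
  move=> x _; rewrite /= indicE; have [xC|xC] := boolP (x \in C).
    rewrite mul1e -(Dv x); congr (lebesgue_rV R n _).
    apply/seteqP; split => y /=; rewrite /xsection/= inE/=; first by case.
    by split => //; rewrite -inE.
  rewrite mul0e -[RHS](measure0 (lebesgue_rV R n)); congr (lebesgue_rV R n _).
  rewrite -subset0 => y; rewrite /xsection/= inE/= => -[+ _].
  by rewrite -inE (negbTE xC).
rewrite ge0_integralZr ?integral_indic ?setIT//; exact: measurableT_comp.
Qed.

Lemma lebesgue_prodC n (E F : set ('rV[R]_n * 'rV[R]_n)) :
  measurable E -> measurable F ->
  (forall y, lebesgue_rV R n [set x | E (x, y)] = lebesgue_rV R n [set x | F (x, y)]) ->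
  (lebesgue_rV R n \x lebesgue_rV R n) E = (lebesgue_rV R n \x lebesgue_rV R n) F.
Proof.
move=> mE mF EF; set mu := lebesgue_rV R n.
(* A product measure is determined by its values on rectangles, so [E] and [F] may be sliced along
   the second variable instead. *)
have swap G : measurable G -> (mu \x mu) G = (mu \x^ mu) G.
  move=> mG; apply: product_measure_unique => //= C D mC mD.
  by rewrite product_measure2E.
rewrite !swap// /product_measure2; apply: eq_integral => y _ /=.
have yE G : ysection G y = [set x | G (x, y)].
  by apply/seteqP; split => x /=; rewrite /ysection/= inE.
by rewrite !yE EF.
Qed.

(* The uniqueness argument for Haar measure: integrate over y first, then over x,
   the indicator of {(x, y) | T x in A, y + T x in B}; for fixed y the shift
   x -> x + w with T w = - y turns it into {T x - y in A, T x in B}. *)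
Lemma lebesgue_rV_additive_swap n (T : 'rV[R]_n -> 'rV[R]_n) (A B : set 'rV[R]_n) :
  measurable_fun [set: 'rV[R]_n] T -> {morph T : x y / (x + y)%R} ->
  (forall y, exists x, T x = y) -> measurable A -> measurable B ->
  lebesgue_rV R n (T @^-1` A) * lebesgue_rV R n B
  = lebesgue_rV R n (T @^-1` B) * lebesgue_rV R n (-%R @^-1` A).
Proof.
move=> mT TD Tsurj mA mB.
have mN : measurable (-%R @^-1` A : set 'rV[R]_n).
  exact: (measurable_preimage (measurable_rVN (@measurable_id _ _ _))).
have mT1 : measurable_fun [set: 'rV[R]_n * 'rV[R]_n] (fun p => T p.1).
  exact: measurableT_comp.
rewrite -(@lebesgue_prod_fibers n (T @^-1` A) (fun x => [set y | B (y + T x)%R]))//;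
  last 2 first.
- exact: measurable_preimage.
- by move=> x; exact: lebesgue_rV_translate.
rewrite -(@lebesgue_prod_fibers n (T @^-1` B) (fun x => [set y | A (T x - y)%R]))//;
  last 2 first.
- exact: measurable_preimage.
- move=> x; rewrite -[RHS](lebesgue_rV_translate (- T x)%R)//.
  congr (lebesgue_rV R n _); apply/seteqP; split => y /=;
  by rewrite opprD opprK addrC.
apply: lebesgue_prodC.
- apply: measurableI; first exact: (measurable_preimage mT1 mA).
  apply: (@measurable_preimage _ _ _ _ (fun p : 'rV[R]_n * 'rV[R]_n => p.2 + T p.1)%R) => //.
  exact: measurable_rVD.
- apply: measurableI; first exact: (measurable_preimage mT1 mB).
  apply: (@measurable_preimage _ _ _ _ (fun p : 'rV[R]_n * 'rV[R]_n => T p.1 - p.2)%R) => //.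
  by apply: measurable_rVD => //; exact: measurable_rVN.
- move=> y /=; have [w Tw] := Tsurj (- y)%R.
  have m2 : measurable [set x : 'rV[R]_n | A (T x) /\ B (y + T x)%R].
    apply: measurableI; first exact: (measurable_preimage mT mA).
    apply: (@measurable_preimage _ _ _ _ (fun x : 'rV[R]_n => y + T x)%R) => //.
    exact: measurable_rVD.
  rewrite -[LHS](lebesgue_rV_translate w)//.
  congr (lebesgue_rV R n _); apply/seteqP; split => x /=;
  by rewrite TD Tw (addrC y) subrK => -[].
Qed.

(** The swap identity with [T] the identity and [B] the unit cube, whose measure is 1. *)
Lemma lebesgue_rVN n (A : set 'rV[R]_n) : measurable A ->
  lebesgue_rV R n (-%R @^-1` A) = lebesgue_rV R n A.
Proof.
move=> mA; pose C := [set x : 'rV[R]_n | forall i, `[0%R, 1%R]%classic (x ord0 i)].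
have mC : measurable C.
  apply: (measurable_rV_box (A := fun=> `[0%R, 1%R]%classic)) => i.
  exact: measurable_itv.
have C1 : lebesgue_rV R n C = 1.
  rewrite (lebesgue_rV_box (A := fun=> `[0%R, 1%R]%classic)); last first.
    by move=> i; exact: measurable_itv.
  rewrite big1// => i _; rewrite lebesgue_measure_itv/= lte_fin ltr01.
  by rewrite oppr0 adde0.
have := @lebesgue_rV_additive_swap n id A C.
rewrite C1 mule1 mul1e => ->//; by move=> y; exists y.
Qed.

(** In cross-multiplied form, [T] changes the measure of all sets by one common factor. Testing on a
    single set of finite positive measure then identifies this factor. *)
Lemma lebesgue_rV_additive n (T : 'rV[R]_n -> 'rV[R]_n) (A B : set 'rV[R]_n) :
  measurable_fun [set: 'rV[R]_n] T -> {morph T : x y / (x + y)%R} ->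
  (forall y, exists x, T x = y) -> measurable A -> measurable B ->
  lebesgue_rV R n (T @^-1` A) * lebesgue_rV R n B
  = lebesgue_rV R n (T @^-1` B) * lebesgue_rV R n A.
Proof.
by move=> mT TD Ts mA mB; rewrite lebesgue_rV_additive_swap// lebesgue_rVN.
Qed.

End translation.

(** * Homotheties and rotations *)

Section linear_invariance.
Local Open Scope ereal_scope.
Context (R : realType).

(** The test set is the unit cube, whose homothetic image is a cube of side [a]. *)
Lemma lebesgue_rV_scale n (a : R) (A : set 'rV[R]_n) : (0 < a)%R -> measurable A ->
  lebesgue_rV R n [set x | A (a^-1 *: x)%R] = (a ^+ n)%:E * lebesgue_rV R n A.
Proof.
move=> a0 mA.
have mI (c : R) (i : 'I_n) : measurable (`[0%R, c]%classic : set (measurableTypeR R)).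
  exact: measurable_itv.
pose C (c : R) := [set x : 'rV[R]_n | forall i, `[0%R, c]%classic (x ord0 i)].
have mC c : measurable (C c) by exact: (measurable_rV_box (mI c)).
have CE c : (0 < c)%R -> lebesgue_rV R n (C c) = (c ^+ n)%:E.
  move=> c0; rewrite (lebesgue_rV_box (mI c)).
  under eq_bigr => i _ do rewrite lebesgue_measure_itv/= lte_fin c0 oppr0 adde0.
  by rewrite prodEFin big_const_ord iter_mulr_1.
have := @lebesgue_rV_additive R n (fun x => a^-1 *: x)%R A (C 1%R).
have -> : (fun x : 'rV[R]_n => a^-1 *: x)%R @^-1` C 1%R = C a.
  apply/seteqP; split=> x Cx i; have := Cx i; rewrite /= !in_itv/= !mxE;
  by rewrite mulrC ler_pdivlMr// mul0r ler_pdivrMr// mul1r.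
rewrite !CE// expr1n mule1; apply => //.
- apply: measurable_fun_rV => i; under eq_fun do rewrite mxE.
  by apply: measurable_funM => //; exact: measurable_rV_coord.
- by move=> x y; rewrite scalerDr.
- by move=> y; exists (a *: y)%R; rewrite scalerA mulVf ?scale1r ?gt_eqF.
Qed.

Lemma dot_ge0 n (x : 'rV[R]_n) : (0 <= dot x x)%R.
Proof. by apply: sumr_ge0 => i _; rewrite -expr2 sqr_ge0. Qed.

Lemma dot_mulmx_orth m n (M : 'M[R]_(m, n)) (x y : 'rV[R]_m) :
  M *m M^T = 1%:M -> dot (x *m M) (y *m M) = dot x y.
Proof.
move=> MM; have := mulmx_tr (x *m M)%R (y *m M)%R.
rewrite trmx_mul mulmxA -(mulmxA x) MM mulmx1 mulmx_tr.
by move=> /matrixP/(_ ord0 ord0); rewrite !mxE eqxx !mulr1n.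
Qed.

Lemma dot_continuous n : continuous (fun x : 'rV[R]_n => dot x x).
Proof.
rewrite /dot; apply: continuous_big => [|i _].
  exact: add_continuous.
have ci : continuous (fun x : 'rV[R]_n => x ord0 i) by exact: coord_continuous.
by move=> x; exact: (continuousM (ci x) (ci x)).
Qed.

Lemma closed_dot_le n (c : R) : closed [set x : 'rV[R]_n | (dot x x <= c)%R].
Proof.
rewrite (_ : mkset _ = (fun x => dot x x) @^-1` [set t | t <= c]%R)//.
by apply: closed_comp; [move=> x _; exact: dot_continuous|exact: closed_le].
Qed.

(** The test set is the Euclidean unit ball, which is its own preimage. To cancel its measure one
    needs it finite and positive, which follows by trapping the ball between two cubes. *)
Lemma lebesgue_rV_orth n (M : 'M[R]_n) (A : set 'rV[R]_n) :
  M *m M^T = 1%:M -> measurable A ->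
  lebesgue_rV R n [set x | A (x *m M)] = lebesgue_rV R n A.
Proof.
move=> MM mA; pose B := [set x : 'rV[R]_n | (dot x x <= 1)%R].
have mB : measurable B by apply: closed_measurable_rV; exact: closed_dot_le.
have := @lebesgue_rV_additive R n (mulmx^~ M) A B.
have -> : mulmx^~ M @^-1` B = B.
  by apply/seteqP; split=> x; rewrite /B/= dot_mulmx_orth.
have mI (c : R) (i : 'I_n) : measurable (`[(- c)%R, c]%classic : set (measurableTypeR R)).
  exact: measurable_itv.
pose C (c : R) := [set x : 'rV[R]_n | forall i, `[(- c)%R, c]%classic (x ord0 i)].
have mC c : measurable (C c) by exact: (measurable_rV_box (mI c)).
have CE c : (0 < c)%R -> lebesgue_rV R n (C c) = ((2 * c) ^+ n)%:E.
  move=> c0; rewrite (lebesgue_rV_box (mI c)).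
  under eq_bigr => i _.
    rewrite lebesgue_measure_itv/= lte_fin gtrN// opprK -EFinD -mulr2n -mulr_natl.
    over.
  by rewrite prodEFin big_const_ord iter_mulr_1.
have B1 : B `<=` C 1%R.
  move=> x; rewrite /B/= => x1 i; rewrite /= in_itv/= -ler_norml.
  rewrite -(@ler_pXn2r _ 2)// ?nnegrE// expr1n real_normK ?num_real// (le_trans _ x1)//.
  by rewrite expr2 /dot (bigD1 i)//= lerDl sumr_ge0// => j _; rewrite -expr2 sqr_ge0.
(* A half-side 1/(n+1) is small enough, since the n squared coordinates then sum to at most n/(n+1);
   it also makes sense for n = 0. *)
have CB : C (n.+1%:R^-1)%R `<=` B.
  move=> x Cx; rewrite /B/= /dot.
  apply: (@le_trans _ _ (\sum_(i < n) n.+1%:R^-1)%R).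
    apply: ler_sum => i _; have := Cx i; rewrite /= in_itv/= -ler_norml => xi.
    rewrite -expr2 -real_normK ?num_real// expr2.
    by rewrite (le_trans (ler_pM _ _ xi xi))// ler_piMl// invf_le1 ?ltr0n// ler1n.
  rewrite sumr_const card_ord -[X in (X <= _)%R]mulr_natl ler_pdivrMr ?ltr0n// mul1r.
  by rewrite ler_nat.
have Bfin : lebesgue_rV R n B < +oo.
  apply: (@le_lt_trans _ _ (lebesgue_rV R n (C 1%R))).
    by apply: le_measure => //; rewrite inE.
  by rewrite CE// ltry.
have Bpos : 0 < lebesgue_rV R n B.
  apply: (@lt_le_trans _ _ (lebesgue_rV R n (C (n.+1%:R^-1)%R))).
    by rewrite CE ?invr_gt0 ?ltr0n// lte_fin exprn_gt0 ?mulr_gt0 ?invr_gt0 ?ltr0n.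
  by apply: le_measure => //; rewrite inE.
have Bfn : lebesgue_rV R n B \is a fin_num by rewrite ge0_fin_numE.
move=> H; apply: (inc_inj (lee_pmul2r Bfn Bpos)) => /=.
rewrite [RHS]muleC; apply: H => //.
- exact: measurable_mulmx_rV.
- by move=> x y; rewrite mulmxDl.
- by move=> y; exists (y *m M^T); rewrite -mulmxA (mulmx1C MM) mulmx1.
Qed.

End linear_invariance.

(** * Gaussian integrals *)

Section gaussian.
Local Open Scope ereal_scope.
Context (R : realType).

(** This is the normal density of variance t/2, freed from its normalising factor. *)
Lemma integral_expR_sqr (t : R) : (0 < t)%R ->
  \int[@lebesgue_measure R]_x (expR (- x ^+ 2 / t))%:E = (Num.sqrt (pi * t))%:E.
Proof.
move=> t0; pose s := Num.sqrt (t / 2).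
have s0 : s != 0%R by rewrite gt_eqF// sqrtr_gt0 divr_gt0.
have sE : (s ^+ 2 *+ 2)%R = t.
  by rewrite sqr_sqrtr ?divr_ge0 ?(ltW t0)// -mulr_natr divfK.
have := integral_normal_pdf 0%R s.
under [X in X = _]eq_integral => x _.
  rewrite normal_pdfE//= EFinM /normal_fun subr0 sE; over.
rewrite ge0_integralZl//=; last 2 first.
- apply/measurable_EFinP; apply: measurableT_comp => //; apply: measurable_funM => //.
  by apply: measurable_funN; exact: measurable_funX.
- by rewrite lee_fin normal_peak_ge0.
rewrite /normal_peak mulrC -mulrnAr sE.
have p0 : (Num.sqrt (pi * t) != 0)%R by rewrite gt_eqF// sqrtr_gt0 mulr_gt0// pi_gt0.
move=> /(congr1 (fun y => (Num.sqrt (pi * t))%:E * y)).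
by rewrite muleA -EFinM divff// mul1e mule1.
Qed.

(** Unnormalised Gaussian in which [t] is twice the variance of each coordinate. Its value at 0 is 1
    in every dimension, so its restriction to a hyperplane through 0 is again [gauss t]. *)
Definition gauss n (t : R) (x : 'rV[R]_n) : R := expR (- dot x x / t).

Lemma continuous_gauss n t : continuous (@gauss n t).
Proof.
move=> x; apply: (@continuous_comp _ _ _ (fun x : 'rV[R]_n => - dot x x / t)%R expR).
  apply: continuousM; last exact: cst_continuous.
  by apply: continuousN; exact: dot_continuous.
exact: continuous_expR.
Qed.

Lemma measurable_gauss n t :
  measurable_fun [set: 'rV[R]_n] (fun x => (gauss t x)%:E).
Proof.
apply/measurable_EFinP; apply: continuous_measurable_rV; exact: continuous_gauss.
Qed.

Lemma gauss_cons n t (p : measurableTypeR R * 'rV[R]_n) :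
  gauss t (rV_cons p) = (expR (- p.1 ^+ 2 / t) * gauss t p.2)%R.
Proof.
rewrite /gauss -expRD -mulrDl -opprD; congr (expR (- _ / _)).
rewrite /dot big_ord_recl rV_cons0 -expr2; congr (_ + _)%R.
by apply: eq_bigr => i _; rewrite rV_consS.
Qed.

(** The Gaussian splits as a product over the first coordinate and the others; Tonelli yields one
    factor per dimension, starting from the Dirac mass in dimension 0. *)
Lemma integral_gauss n (t : R) : (0 < t)%R ->
  \int[lebesgue_rV R n]_x (gauss t x)%:E = (Num.sqrt (pi * t) ^+ n)%:E.
Proof.
move=> t0; elim: n => [|n IH].
  rewrite /= integral_dirac//=; last exact: measurable_gauss.
  by rewrite diracT mul1e /gauss /dot big_ord0 oppr0 mul0r expR0.
rewrite /= /lebesgue_rV_cons ge0_integral_pushforward//=; last 2 first.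
- exact: measurable_gauss.
- by move=> x _; rewrite lee_fin expR_ge0.
rewrite preimage_setT fubini_tonelli1//=; last 2 first.
- exact: (measurableT_comp (@measurable_gauss n.+1 t) (@measurable_rV_cons R n)).
- by move=> x; rewrite lee_fin expR_ge0.
rewrite /fubini_F.
have fiber (x : R) : \int[lebesgue_rV R n]_y (gauss t (rV_cons (x, y)))%:E
    = (expR (- x ^+ 2 / t))%:E * (Num.sqrt (pi * t) ^+ n)%:E.
  rewrite -IH -ge0_integralZl//=; last 2 first.
  - exact: measurable_gauss.
  - by move=> y _; rewrite lee_fin expR_ge0.
  by apply: eq_integral => y _; rewrite gauss_cons.
under eq_integral do rewrite /= fiber.
rewrite ge0_integralZr//=.
  by rewrite integral_expR_sqr// -EFinM exprS.
apply/measurable_EFinP; apply: measurableT_comp => //; apply: measurable_funM => //.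
by apply: measurable_funN; exact: measurable_funX.
Qed.

(* On {|x|^2 >= s} the Gaussian exp(-|x|^2/t) is at most exp(-s/(2t))
   times the one of parameter 2t. *)
Lemma gauss_mass_le n (t s : R) (K : set 'rV[R]_n) (f : 'rV[R]_n -> R) :
  (0 < t)%R -> measurable K ->
  measurable_fun [set: 'rV[R]_n] (f : _ -> measurableTypeR R) ->
  (forall x, 0 <= f x)%R ->
  (forall x, ~ K x -> dot x x <= s -> gauss t x <= f x)%R ->
  (Num.sqrt (pi * t) ^+ n)%:E <= \int[lebesgue_rV R n]_x (f x)%:E
    + (expR (- s / (2 * t)) * Num.sqrt (pi * (2 * t)) ^+ n)%:E + lebesgue_rV R n K.
Proof.
move=> t0 mK mf f0 fK; rewrite -integral_gauss// EFinM -integral_gauss ?mulr_gt0//.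
rewrite -ge0_integralZl//=; last 2 first.
- exact: measurable_gauss.
- by move=> y _; rewrite lee_fin expR_ge0.
have mg : measurable_fun [set: 'rV[R]_n]
    (fun x => (expR (- s / (2 * t)))%:E * (gauss (2 * t) x)%:E).
  by apply: emeasurable_funM => //; exact: measurable_gauss.
have mf' : measurable_fun [set: 'rV[R]_n] (fun x => (f x)%:E) by exact/measurable_EFinP.
have m1 : measurable_fun [set: 'rV[R]_n] (fun x => (\1_K x)%:E : \bar R).
  by apply/measurable_EFinP; exact: measurable_indic.
have -> : lebesgue_rV R n K = \int[lebesgue_rV R n]_x (\1_K x)%:E.
  by rewrite integral_indic// setIT.
rewrite -ge0_integralD//=; last 2 first.
- by move=> x _; rewrite lee_fin.
- by move=> x _; rewrite -EFinM lee_fin mulr_ge0 ?expR_ge0.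
rewrite -ge0_integralD//=; last 2 first.
- by move=> x _; rewrite -EFinM -EFinD lee_fin addr_ge0 ?mulr_ge0 ?expR_ge0.
- exact: emeasurable_funD.
apply: ge0_le_integral => //=.
- by move=> x _; rewrite lee_fin expR_ge0.
- exact: measurable_gauss.
- by apply: emeasurable_funD => //; exact: emeasurable_funD.
move=> x _; rewrite -EFinM -!EFinD lee_fin.
(* One summand suffices at each point: on [K] the indicator, as the Gaussian is at most 1; off [K],
   the function [f] up to squared norm [s], and the wider Gaussian beyond. *)
have [Kx|nKx] := pselect (K x).
  rewrite indicE mem_set//= -[leLHS]add0r lerD ?addr_ge0 ?mulr_ge0 ?expR_ge0//.
  by rewrite -[leRHS]expR0 ler_expR mulNr oppr_le0 divr_ge0 ?dot_ge0 ?(ltW t0).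
rewrite indicE memNset//= addr0.
have [xs|sx] := lerP (dot x x) s.
  by rewrite -[leLHS]addr0 lerD ?fK ?mulr_ge0 ?expR_ge0.
rewrite -[leLHS]add0r lerD//.
rewrite /gauss -expRD ler_expR -mulrDl ler_pdivlMr ?mulr_gt0//.
rewrite mulrCA -mulrA mulVf ?gt_eqF// mulr1.
lra.
Qed.

End gaussian.

(** * Sections of convex bodies and cutoff functions *)

Section convex.
Context (R : realType).

Lemma convex_setP n (Q : set 'rV[R]_n) (x y : 'rV[R]_n) (a b : R) :
  convex_set (Q : set (convex_lmodType 'rV[R]_n)) -> Q x -> Q y ->
  0 <= a -> 0 <= b -> a + b = 1 -> Q (a *: x + b *: y).
Proof.
move=> cQ Qx Qy a0 b0 ab.
have a1 : a <= 1 by lra.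
have <- : 1 - a = b by rewrite -ab addrAC subrr add0r.
by have := cQ x y (@Itv01 R a a0 a1); rewrite !inE => /(_ Qx Qy).
Qed.

(* 6 Q contains the orthogonal sum of the segment [-3 rho, 3 rho] xi and of the
   section of 3 Q by the hyperplane orthogonal to xi. *)
Lemma lebesgue_rV_section_le m (xi : 'rV[R]_m.+1) (B : 'M[R]_(m, m.+1))
    (Q : set 'rV[R]_m.+1) (rho : R) :
  0 < rho -> l2norm xi = 1 -> perp_frame xi B -> measurable Q ->
  (forall x y, Q x -> Q y -> Q (2^-1 *: x + 2^-1 *: y)) ->
  (forall x, dot x x <= rho ^+ 2 -> Q x) ->
  ((6 * rho)%:E * lebesgue_rV R m [set y | Q (3^-1 *: (y *m B))]
   <= (6 ^+ m.+1)%:E * lebesgue_rV R m.+1 Q)%E.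
Proof.
move=> rho0 xi1 [BB Bxi] mQ Qmid Qball.
have xixi := l2norm1_dot xi1.
have xiB : xi *m B^T = 0 by rewrite -[xi]trmxK -trmx_mul Bxi trmx0.
(* The rows of this orthogonal matrix are [xi] followed by the frame, so the first coordinate runs
   along [xi] and the others along the hyperplane. *)
pose M : 'M[R]_(1 + m) := col_mx xi B.
have MM : M *m M^T = 1%:M.
  by rewrite tr_col_mx mul_col_row mulmx_tr xixi xiB Bxi BB -scalar_mx_block.
have consM (p : measurableTypeR R * 'rV[R]_m) :
    rV_cons p *m M = p.1 *: xi + p.2 *m B.
  rewrite -mul_scalar_mx. exact: (@mul_row_col R 1 1 m m.+1 (p.1)%:M p.2 xi B).
have m6 : measurable [set x : 'rV[R]_m.+1 | Q (6^-1 *: x)].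
  apply: (@measurable_preimage _ _ _ _ (fun x : 'rV[R]_m.+1 => 6^-1 *: x)) => //.
  apply: measurable_fun_rV => i; under eq_fun do rewrite mxE.
  by apply: measurable_funM => //; exact: measurable_rV_coord.
have mK : measurable [set y : 'rV[R]_m | Q (3^-1 *: (y *m B))].
  apply: (@measurable_preimage _ _ _ _ (fun y : 'rV[R]_m => 3^-1 *: (y *m B))) => //.
  have := @measurable_mulmx_rV R m.+1 m (3^-1 *: B).
  by under eq_fun do rewrite -scalemxAr.
rewrite -(lebesgue_rV_scale _ mQ)// -(lebesgue_rV_orth MM m6).
have -> : (6 * rho)%:E = lebesgue_measure `[- (3 * rho), 3 * rho]%classic.
  rewrite lebesgue_measure_itv/= lte_fin gtrN ?mulr_gt0// -EFinB.
  by congr EFin; ring.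
rewrite -product_measure1E//=.
rewrite /lebesgue_rV_cons /pushforward; apply: le_measure; rewrite ?inE.
- by apply: measurableX => //; exact: measurable_itv.
- exact: (measurable_preimage (measurableT_comp (@measurable_mulmx_rV R m.+1 m.+1 M)
    (@measurable_rV_cons R m)) m6).
move=> [t y] [/= + Ky]; rewrite in_itv/= -ler_norml => t3.
(* A sixth of t xi + y B is the midpoint of t xi / 3, which lies in the ball of radius [rho], and of
   y B / 3, which lies in [Q]. *)
rewrite consM/= (_ : _ *: _ =
    2^-1 *: ((3^-1 * t) *: xi) + 2^-1 *: (3^-1 *: (y *m B))).
  apply: Qmid => //; apply: Qball.
  have -> : dot ((3^-1 * t) *: xi) ((3^-1 * t) *: xi) = (3^-1 * t) ^+ 2.
    rewrite -[RHS]mulr1 -xixi /dot mulr_sumr; apply: eq_bigr => i _.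
    by rewrite !mxE; ring.
  rewrite -[leLHS]real_normK ?num_real// ler_pXn2r ?nnegrE ?(ltW rho0)//.
  by rewrite normrM ger0_norm// ler_pdivrMl.
by rewrite scalerDr !scalerA; congr (_ *: _ + _ *: _); field.
Qed.

End convex.

Section cutoff.
Context (R : realType).

(** The margin [e] separates [D] from the complement of [E] uniformly, which gives a Urysohn
    function. Averaging it with its reflection makes it even, and the symmetry of [D] and [E]
    preserves the prescribed values. *)
Lemma even_cutoff n (D E : set 'rV[R]_n) (e : R) : 0 < e ->
  (forall x, D x -> D (- x)) -> (forall x, E x -> E (- x)) ->
  (forall x y, D x -> ball x e y -> E y) ->
  exists w : 'rV[R]_n -> R, [/\ even_fun w, continuous w,
    forall x, 0 <= w x <= 1, forall x, D x -> w x = 0 & forall x, ~ E x -> w x = 1].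
Proof.
move=> e0 Ds Es DE.
have US : uniform_separator D (~` E).
  apply: uniform_separatorW; exists [set xy | ball xy.1 e xy.2].
    exact: (@entourage_ball R 'rV[R]_n (PosNum e0)).
  rewrite -subset0 => -[x y] [/= [Dx nEy]].
  by move=> /(DE _ _ Dx).
pose u := @Urysohn _ R D (~` E).
have u0 x : D x -> u x = 0 by move=> Dx; apply: (Urysohn_sub0 US); exists x.
have u1 x : ~ E x -> u x = 1 by move=> Ex; apply: (Urysohn_sub1 US); exists x.
have u01 x : 0 <= u x <= 1.
  have := @Urysohn_range _ R D (~` E) (u x); rewrite /= in_itv/=; apply.
  by exists x.
have cu : continuous u by exact: Urysohn_continuous.
exists (fun x => (u x + u (- x)) / 2); split.
- by move=> x; rewrite opprK addrC.
- have cuN : continuous (fun x : 'rV[R]_n => u (- x)).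
    move=> x; apply: (@continuous_comp _ _ _ (-%R : 'rV[R]_n -> 'rV[R]_n) u); last exact: cu.
    exact: opp_continuous.
  have cuD : continuous (fun x : 'rV[R]_n => u x + u (- x)).
    by move=> x; exact: (@continuousD R R^o _ _ _ _ (cu x) (cuN x)).
  by move=> x; apply: (@continuousM R _ _ _ _ (cuD x)); exact: cst_continuous.
- by move=> x; have := u01 x; have := u01 (- x); lra.
- by move=> x Dx; rewrite u0 ?u0; [rewrite addr0 mul0r|exact: Ds|].
- move=> x Ex; rewrite !u1// => [|/Es]; last by rewrite opprK.
  by rewrite -mulr2n -[1 *+ 2]mulr_natr mul1r divff.
Qed.

End cutoff.

(** * Mass of a truncated Gaussian *)

Section balls.
Context (R : realType).

Lemma dotZ n (a : R) (x : 'rV[R]_n) : dot (a *: x) (a *: x) = a ^+ 2 * dot x x.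
Proof.
by rewrite /dot mulr_sumr; apply: eq_bigr => i _; rewrite !mxE; ring.
Qed.

Lemma dilate_l2ballE n (r : R) : 0 < r ->
  dilate r (@l2ball R n) = [set x | dot x x <= r ^+ 2].
Proof.
move=> r0; apply/seteqP; split=> [_ [x x1 <-]|x xr] /=.
  rewrite dotZ ler_piMr ?sqr_ge0//; move: x1; rewrite /l2ball/= /l2norm => x1.
  by rewrite -[leLHS]sqr_sqrtr ?dot_ge0// expr_le1 ?sqrtr_ge0.
exists (r^-1 *: x); last by rewrite scalerA divff ?scale1r ?gt_eqF.
rewrite /l2ball/= /l2norm dotZ -[leRHS]sqrtr1 ler_sqrt// exprVn.
by rewrite ler_pdivrMl ?exprn_gt0// mulr1.
Qed.

(** [ball] refers to the sup norm. Passing to the Euclidean norm costs a factor sqrt n, exactly the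
    one present in the inner radius r0 sqrt n of [Q]. *)
Lemma dot_ball_le n (e : R) (x y : 'rV[R]_n) : ball x e y ->
  dot (x - y) (x - y) <= (e * Num.sqrt n%:R) ^+ 2.
Proof.
move=> [e0 xye]; rewrite exprMn sqr_sqrtr ?ler0n//.
apply: (@le_trans _ _ (\sum_(i < n) e ^+ 2)); last first.
  by rewrite sumr_const card_ord mulr_natr.
apply: ler_sum => i _; rewrite -expr2 !mxE -real_normK ?num_real//.
by rewrite ler_pXn2r ?nnegrE ?(ltW e0)//; exact/ltW/xye.
Qed.

End balls.

Section mass.
Context (R : realType).

(** Doubling the parameter costs sqrt 2 per dimension. With sqrt 2 at most 3/2 and exp(-1) at most
    1/2, the net factor is at most (3/4)^n, which is below 1/4 from n = 5 on. Keeping [k] apart from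
    [n] covers hyperplanes too. *)
Lemma gauss_tail_le (a : R) k n : 0 < a -> (k <= n)%N -> (5 <= n)%N ->
  expR (- n%:R) * Num.sqrt (pi * (2 * a)) ^+ k <= Num.sqrt (pi * a) ^+ k / 4.
Proof.
move=> a0 kn n5; have pa : 0 <= pi * a by rewrite mulr_ge0 ?pi_ge0 ?ltW.
rewrite mulrCA sqrtrM// exprMn mulrA mulrC ler_wpM2l ?exprn_ge0 ?sqrtr_ge0//.
have s2 : Num.sqrt 2 <= 3 / 2 :> R.
  rewrite -(@ler_pXn2r _ 2) ?nnegrE ?sqrtr_ge0 ?divr_ge0// sqr_sqrtr//.
  by rewrite expr_div_n -!natrX ler_pdivlMr ?ltr0n// -natrM ler_nat.
have e1 : expR (- 1) <= 1 / 2 :> R.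
  rewrite expRN mul1r lef_pV2 ?posrE ?expR_gt0//.
  by have := @expR_ge1Dx R 1; lra.
rewrite -[n%:R]mulr1 -mulrN expRM_natl.
apply: (@le_trans _ _ ((1 / 2) ^+ n * (3 / 2) ^+ n)).
  apply: ler_pM; rewrite ?exprn_ge0 ?expR_ge0 ?sqrtr_ge0//.
    by rewrite lerXn2r ?nnegrE ?expR_ge0// divr_ge0.
  apply: (@le_trans _ _ ((3 / 2) ^+ k)).
    by rewrite lerXn2r ?nnegrE ?sqrtr_ge0// divr_ge0.
  by rewrite ler_eXn2l//; lra.
rewrite -exprMn; apply: (@le_trans _ _ ((1 / 2 * (3 / 2)) ^+ 5)).
  by rewrite ler_wiXn2l//; lra.
lra.
Qed.

(** A quarter of the mass is lost to the tail and a quarter to [K]. The squared radius 2 a n is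
    chosen so that the tail factor is exp(-n). *)
Lemma gauss_half_mass_le (a : R) k n (K : set 'rV[R]_k) (f : 'rV[R]_k -> R) :
  0 < a -> (k <= n)%N -> (5 <= n)%N -> measurable K ->
  measurable_fun [set: 'rV[R]_k] (f : _ -> measurableTypeR R) ->
  (forall x, 0 <= f x) ->
  (forall x, ~ K x -> dot x x <= 2 * a * n%:R -> gauss a x <= f x) ->
  (lebesgue_rV R k K <= (Num.sqrt (pi * a) ^+ k / 4)%:E)%E ->
  ((Num.sqrt (pi * a) ^+ k / 2)%:E <= \int[lebesgue_rV R k]_x (f x)%:E)%E.
Proof.
move=> a0 kn n5 mK mf f0 fK Kle.
have := gauss_mass_le a0 mK mf f0 fK.
have -> : - (2 * a * n%:R) / (2 * a) = - n%:R :> R.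
  by rewrite -mulNr mulrC mulNr mulrN mulrA mulVf ?mul1r// mulf_neq0 ?gt_eqF.
set I := (\int[_]_x _)%E => le1.
have I0 : (0 <= I)%E by apply: integral_ge0 => x _; rewrite lee_fin.
have : (((Num.sqrt (pi * a)) ^+ k)%:E <= I + (Num.sqrt (pi * a) ^+ k / 4)%:E
    + (Num.sqrt (pi * a) ^+ k / 4)%:E)%E.
  apply: (le_trans le1); apply: leeD => //; apply: leeD => //.
  by rewrite lee_fin gauss_tail_le.
case: I I0 {le1} => [r _|_ _|//]; last by rewrite leey.
by rewrite -!EFinD !lee_fin; lra.
Qed.

End mass.

(** * The density *)

Section assembly.
Context (R : realType).

Lemma poweR_inv_le (x : \bar R) (y : R) n : (0 < n)%N -> (0 <= x)%E -> 0 <= y ->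
  (x `^ (n%:R^-1) <= y%:E)%E -> (x <= (y ^+ n)%:E)%E.
Proof.
move=> n0 x0 y0 xy; have n0' : n%:R != 0 :> R by rewrite pnatr_eq0 -lt0n.
have -> : (x = (x `^ n%:R^-1) `^ n%:R)%E by rewrite -poweRrM mulVf// poweRe1.
rewrite -powR_mulrn// -poweR_EFin.
apply: (@gt0_ler_poweR R n%:R (ler0n _ _)) => //.
  by rewrite in_itv/= poweR_ge0 leey.
by rewrite in_itv/= lee_fin y0 leey.
Qed.

Lemma integral_lebesgue_perp m (xi : 'rV[R]_m.+1) (f : 'rV[R]_m.+1 -> R) :
  l2norm xi = 1 -> continuous f -> (forall x, 0 <= f x) ->
  (\int[lebesgue_perp xi]_(x in perp xi) (f x)%:E
   = \int[lebesgue_rV R m]_y (f (perp_embedding xi y))%:E)%E.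
Proof.
move=> xi1 cf f0.
have mp : measurable (perp xi).
  have -> : perp xi = (fun x => x *m xi^T) @^-1` [set y : 'rV[R]_1 | y ord0 ord0 = 0].
    by apply/seteqP; split=> x; rewrite /perp/= mulmx_tr mxE eqxx mulr1n.
  apply: measurable_preimage; first exact: measurable_mulmx_rV.
  apply: (@measurable_preimage _ _ _ _ (fun y : 'rV[R]_1 => y ord0 ord0) [set 0]) => //.
  exact: measurable_rV_coord.
rewrite /lebesgue_perp ge0_integral_pushforward//; last 2 first.
- by apply/measurable_EFinP/measurable_funTS; apply: continuous_measurable_rV.
- by move=> x _; rewrite lee_fin.
congr (integral _ _ _).
apply/seteqP; split=> y _ //=; rewrite -(range_perp_embedding xi1).
by exists y.
Qed.

Lemma gauss_mulmx m n (B : 'M[R]_(m, n)) (t : R) (y : 'rV[R]_m) :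
  B *m B^T = 1%:M -> gauss t (y *m B) = gauss t y.
Proof. by move=> BB; rewrite /gauss dot_mulmx_orth. Qed.

End assembly.

(** The density is the Gaussian times a radial cutoff times [w], normalised. The set [D] is to be
    avoided, while [E] is where [w] may alter the Gaussian; the two volume bounds make this loss at
    most a quarter, in the whole space and in each hyperplane. *)
Lemma truncated_gauss_density (R : realType) m (a : R) (w : 'rV[R]_m.+1 -> R)
    (D E : set 'rV[R]_m.+1) :
  (4 <= m)%N -> 0 < a -> even_fun w -> continuous w -> measurable E ->
  (forall x, 0 <= w x <= 1) -> (forall x, D x -> w x = 0) ->
  (forall x, ~ E x -> w x = 1) ->
  (lebesgue_rV R m.+1 E <= (Num.sqrt (pi * a) ^+ m.+1 / 4)%:E)%E ->
  (forall xi : 'rV[R]_m.+1, l2norm xi = 1 ->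
    (lebesgue_rV R m (perp_embedding xi @^-1` E)
      <= (Num.sqrt (pi * a) ^+ m / 4)%:E)%E) ->
  exists h : 'rV[R]_m.+1 -> R,
    [/\ even_fun h, continuous h, probability_density h,
        forall x, h x != 0 -> dot x x <= 4 * a * m.+1%:R /\ ~ D x &
        forall xi : 'rV[R]_m.+1, l2norm xi = 1 ->
          ((2 * Num.sqrt (pi * a))^-1%:E
            <= \int[lebesgue_perp xi]_(x in perp xi) (h x)%:E)%E].
Proof.
move=> m4 a0 we cw mE w01 wD wE volE volsec.
set g := Num.sqrt (pi * a).
have g0 : 0 < g by rewrite sqrtr_gt0 mulr_gt0 ?pi_gt0.
pose r2 := 2 * a * m.+1%:R.
have r20 : 0 < r2 by rewrite !mulr_gt0.
(* Equal to 1 up to squared norm [r2], and to 0 from 2 [r2] on, which is the bound 4 a (m+1)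
   required of the support. *)
pose phi (x : 'rV[R]_m.+1) := Num.min 1 (Num.max 0 (2 - dot x x / r2)).
have cphi : continuous phi.
  have cd : continuous (fun x : 'rV[R]_m.+1 => dot x x / r2).
    move=> x; apply: (@continuousM R _ _ _ _ (@dot_continuous R m.+1 x)).
    exact: cst_continuous.
  have c2 : continuous (fun x : 'rV[R]_m.+1 => 2 - dot x x / r2).
    by move=> x; apply: (@continuousB R R^o _ _ _ _ _ (cd x)); exact: cst_continuous.
  have cM : continuous (fun x : 'rV[R]_m.+1 => Num.max 0 (2 - dot x x / r2)).
    by move=> x; apply: (@continuous_max R _ _ _ _ _ (c2 x)); exact: cst_continuous.
  by move=> x; apply: (@continuous_min R _ _ _ _ _ (cM x)); exact: cst_continuous.
have phi01 x : 0 <= phi x <= 1.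
  by rewrite /phi le_min ler01 le_max lexx/= ge_min lexx.
pose h0 x := gauss a x * (phi x * w x).
have ch0 : continuous h0.
  move=> x; apply: (@continuousM R _ _ _ _ (@continuous_gauss R m.+1 a x)).
  exact: (@continuousM R _ _ _ _ (cphi x) (cw x)).
have dotN (x : 'rV[R]_m.+1) : dot (- x) (- x) = dot x x.
  by apply: eq_bigr => i _; rewrite !mxE mulrNN.
have h0e : even_fun h0 by move=> x; rewrite /h0 /phi /gauss dotN we.
have h0_ge0 x : 0 <= h0 x.
  have /andP[p0 _] := phi01 x; have /andP[w0 _] := w01 x.
  by rewrite /h0 !mulr_ge0 ?expR_ge0.
have h0_le x : h0 x <= gauss a x.
  have /andP[p0 p1] := phi01 x; have /andP[w0 w1] := w01 x.
  by rewrite /h0 ler_piMr ?expR_ge0// mulr_ile1.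
have h0E x : ~ E x -> dot x x <= r2 -> h0 x = gauss a x.
  move=> nEx xr; rewrite /h0 wE// mulr1 /phi min_l ?mulr1// le_max; apply/orP; right.
  suff : dot x x / r2 <= 1 by lra.
  by rewrite ler_pdivrMr// mul1r.
have h0supp x : h0 x != 0 -> dot x x <= 4 * a * m.+1%:R /\ ~ D x.
  rewrite /h0 !mulf_eq0 !negb_or => /and3P[_ px wx]; split; last first.
    by move=> /wD /eqP; rewrite (negbTE wx).
  rewrite leNgt; apply: contra px => xr.
  rewrite /phi (_ : Num.max _ _ = 0) ?min_r//; apply/max_idPl.
  suff : 2 <= dot x x / r2 by lra.
  by rewrite ler_pdivlMr// /r2; lra.
have mh0 : measurable_fun [set: 'rV[R]_m.+1] (h0 : _ -> measurableTypeR R).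
  exact: continuous_measurable_rV.
pose I := (\int[lebesgue_rV R m.+1]_x (h0 x)%:E)%E.
have I_ge : ((g ^+ m.+1 / 2)%:E <= I)%E.
  apply: (gauss_half_mass_le (K := E) a0 (leqnn _)) => //.
  by move=> x nEx xr; rewrite h0E.
have I_le : (I <= (g ^+ m.+1)%:E)%E.
  rewrite -integral_gauss//; apply: ge0_le_integral => //=.
  - by move=> x _; rewrite lee_fin.
  - exact/measurable_EFinP.
  - exact: measurable_gauss.
  - by move=> x _; rewrite lee_fin.
have Ifin : I \is a fin_num.
  rewrite ge0_fin_numE ?(le_lt_trans I_le) ?ltry//.
  by apply: integral_ge0 => x _; rewrite lee_fin.
pose Z := fine I.
have IE : I = Z%:E by rewrite fineK.
have Z0 : 0 < Z.
  rewrite -lte_fin -IE; apply: lt_le_trans I_ge.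
  by rewrite lte_fin divr_gt0 ?exprn_gt0.
have Zg : Z <= g ^+ m.+1 by rewrite -lee_fin -IE.
have hge0 x : 0 <= Z^-1 * h0 x by rewrite mulr_ge0 ?invr_ge0 ?(ltW Z0).
have ch : continuous (fun x => Z^-1 * h0 x).
  by move=> x; apply: (@continuousM R _ _ _ _ _ (ch0 x)); exact: cst_continuous.
exists (fun x => Z^-1 * h0 x); split => //.
- by move=> x; rewrite h0e.
- split => //; under eq_integral do rewrite EFinM.
  rewrite ge0_integralZl//=.
  + by rewrite -/I IE -EFinM mulVf// gt_eqF.
  + exact/measurable_EFinP.
  + by move=> x _; rewrite lee_fin.
  + by rewrite lee_fin invr_ge0 ltW.
- by move=> x; rewrite mulf_eq0 negb_or => /andP[_]; exact: h0supp.
move=> xi xi1; rewrite integral_lebesgue_perp//.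
have [BB Bxi] := some_perp_frameP xi1.
have memb : measurable_fun [set: 'rV[R]_m] (perp_embedding xi).
  exact: measurable_mulmx_rV.
under eq_integral do rewrite EFinM.
rewrite ge0_integralZl//=; last 3 first.
- by apply/measurable_EFinP; exact: (measurableT_comp mh0 memb).
- by move=> x _; rewrite lee_fin.
- by rewrite lee_fin invr_ge0 ltW.
have sec : ((g ^+ m / 2)%:E
    <= \int[lebesgue_rV R m]_y (h0 (perp_embedding xi y))%:E)%E.
  apply: (gauss_half_mass_le (K := perp_embedding xi @^-1` E) a0 (leqnSn _)) => //.
  - exact: measurable_preimage.
  - exact: (measurableT_comp mh0 memb).
  - by move=> y nEy yr; rewrite h0E ?gauss_mulmx// dot_mulmx_orth.
  - exact: volsec.
apply: (@le_trans _ _ ((Z^-1)%:E * (g ^+ m / 2)%:E)%E); last first.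
  by apply: lee_wpmul2l => //; rewrite lee_fin invr_ge0 ltW.
(* The normaliser is at most g^(m+1) and the section carries at least g^m / 2, so the quotient is at
   least 1/(2g). *)
rewrite -EFinM lee_fin ler_pdivlMl// invfM.
apply: (@le_trans _ _ (g ^+ m.+1 * (2^-1 * g^-1))).
  by rewrite ler_wpM2r// mulr_ge0 ?invr_ge0// ltW.
rewrite exprSr le_eqVlt; apply/orP; left; apply/eqP; field.
by rewrite gt_eqF.
Qed.

(** * Choice of the constants and volume estimates for 3 Q and its sections *)

Theorem proposition4p2 (R : realType) (r0 C0 : R) (r0_gt0 : 0 < r0) (C0_gt0 : 0 < C0) :
  exists2 Astar : R, 0 < Astar &
  forall A : R, Astar <= A ->
  exists (c : R) (n0 : nat), 0 < c /\
  forall (n : nat) (v : R) (Q : set 'rV[R]_n),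
    (n0 <= n)%N -> 1 <= v -> v <= Num.sqrt n%:R ->
    convex_body Q -> origin_symmetric Q ->
    dilate (r0 * Num.sqrt n%:R) (@l2ball R n) `<=` Q ->
    (lebesgue_rV R n Q `^ (n%:R^-1) <= (C0 * v)%:E)%E ->
    let U := dilate (A * v * Num.sqrt n%:R) (@l2ball R n) in
    exists h : 'rV[R]_n -> R,
      [/\ even_fun h, continuous h, probability_density h,
          supp h `<=` U `\` (dilate (1 + n%:R^-1) Q)° &
          forall xi : 'rV[R]_n, l2norm xi = 1 ->
            ((c / v)%:E <= \int[lebesgue_perp xi]_(x in perp xi) (h x)%:E)%E].
Proof.
(* With b = A v / 2 this gives 12 C0 v <= b, hence 3 C0 v <= b/4 for the volume of 3 Q and 6 C0 v <=
   b/2 for its sections. *)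
exists (24 * C0); first by rewrite mulr_gt0.
move=> A leA; have A0 : 0 < A by lra.
(* The 5 serves the Gaussian tail. The other bound gives 4 C0 / r0 <= n <= 2^(n-1), used for the
   sections. *)
pose N := maxn 5 (Num.bound (4 * C0 / r0)).
(* Here g = sqrt pi * A v / 2, so that 1/(2g) is c/v exactly. *)
exists (Num.sqrt pi * A)^-1, N; split.
  by rewrite invr_gt0 mulr_gt0// sqrtr_gt0 pi_gt0.
case=> [|m] v Q; rewrite /N geq_max => /andP[] // m5 mN v1 vn.
move=> [cptQ convQ _] symQ ballQ volQ.
have v0 : 0 < v by lra.
have n0 : 0 < m.+1%:R :> R by rewrite ltr0n.
have sn0 : 0 < Num.sqrt m.+1%:R :> R by rewrite sqrtr_gt0.
(* The choice of [b] makes 4 a n the squared radius of [U]. *)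
pose b := A * v / 2; pose a := b ^+ 2; pose rho := r0 * Num.sqrt m.+1%:R.
have b0 : 0 < b by rewrite divr_gt0// mulr_gt0.
have C0v0 : 0 < C0 * v by rewrite mulr_gt0.
have C0vb : 12 * (C0 * v) <= b.
  by rewrite /b; have : 24 * C0 * v <= A * v; [rewrite ler_wpM2r// ltW|lra].
have a0 : 0 < a by rewrite exprn_gt0.
have rho0 : 0 < rho by rewrite mulr_gt0.
have gE : Num.sqrt (pi * a) = Num.sqrt pi * b.
  by rewrite sqrtrM ?pi_ge0// sqrtr_sqr gtr0_norm.
have b_le_g : b <= Num.sqrt (pi * a).
  rewrite gE ler_peMl ?(ltW b0)// -sqrtr1 ler_wsqrtr//.
  by have := @pi_ge2 R; lra.
have Qrho x : dot x x <= rho ^+ 2 -> Q x.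
  by move=> xr; apply: ballQ; rewrite dilate_l2ballE.
have mQ : measurable Q.
  by apply: closed_measurable_rV; exact: compact_closed.
have Q0 : Q 0.
  by apply: Qrho; rewrite /dot big1 ?sqr_ge0// => i _; rewrite mxE mul0r.
have Qle : (lebesgue_rV R m.+1 Q <= ((C0 * v) ^+ m.+1)%:E)%E.
  by apply: poweR_inv_le => //; rewrite mulr_ge0 ?ltW.
pose D := dilate (1 + m.+1%:R^-1) Q; pose E := [set x | Q (3^-1 *: x)].
have mE : measurable E.
  apply: (@measurable_preimage _ _ _ _ (fun x : 'rV[R]_m.+1 => 3^-1 *: x)) => //.
  apply: measurable_fun_rV => i; under eq_fun do rewrite mxE.
  by apply: measurable_funM => //; exact: measurable_rV_coord.
have DE x y : D x -> ball x r0 y -> E y.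
  move=> [q Qq <-] /dot_ball_le xy; rewrite /E/=.
  set z := _ - y in xy.
  (* With x = (1 + 1/n) q, the point y/3 is x/3 + (y - x)/3. The first term is 2/3 of x/2, which
     lies between 0 and q because 1 + 1/n <= 2; the second is a third of a point of the inscribed
     ball. *)
  rewrite (_ : 3^-1 *: y = (2 / 3) *: (((1 + m.+1%:R^-1) / 2) *: q + (1 - (1 + m.+1%:R^-1) / 2) *: 0)
      + 3^-1 *: (- z)); last first.
    rewrite /z scaler0 addr0 opprB scalerBr scalerA addrCA -[LHS]addr0; congr (_ + _).
    by rewrite scalerA -scalerBl (_ : _ - _ = 0) ?scale0r//; field; rewrite gt_eqF.
  have n1 : m.+1%:R^-1 <= 1 :> R by rewrite invf_le1// ler1n.
  have n1' : 0 <= m.+1%:R^-1 :> R by rewrite invr_ge0 ltW.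
  move: n1 n1'; move: (m.+1%:R^-1) => p p1 p0.
  apply: convex_setP => //; [|exact/symQ/Qrho|lra].
  by apply: convex_setP => //; lra.
have symD x : D x -> D (- x).
  by move=> [q /symQ Qq <-]; exists (- q) => //; rewrite scalerN.
have symE x : E x -> E (- x) by move=> /symQ; rewrite /E/= scalerN.
have [w [we cw w01 wD wE]] := even_cutoff r0_gt0 symD symE DE.
have volE : (lebesgue_rV R m.+1 E <= (Num.sqrt (pi * a) ^+ m.+1 / 4)%:E)%E.
  rewrite /E lebesgue_rV_scale//.
  apply: (@le_trans _ _ ((3 ^+ m.+1)%:E * ((C0 * v) ^+ m.+1)%:E)%E).
    by apply: lee_wpmul2l => //; rewrite lee_fin exprn_ge0.
  rewrite -EFinM lee_fin -exprMn.
  (* Since b <= g, the power 4^n in the denominator leaves more than the needed factor 4. *)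
  apply: (@le_trans _ _ ((b / 4) ^+ m.+1)).
    by rewrite lerXn2r ?nnegrE ?mulr_ge0 ?invr_ge0 ?(ltW C0v0) ?(ltW b0)//; lra.
  rewrite expr_div_n; apply: ler_pM; rewrite ?exprn_ge0 ?invr_ge0 ?exprn_ge0 ?(ltW b0)//.
    by rewrite lerXn2r ?nnegrE ?sqrtr_ge0 ?(ltW b0).
  by rewrite lef_pV2 ?posrE ?exprn_gt0// exprS ler_peMr// exprn_ege1// ler1n.
have volsec (xi : 'rV[R]_m.+1) : l2norm xi = 1 ->
    (lebesgue_rV R m (perp_embedding xi @^-1` E)
      <= (Num.sqrt (pi * a) ^+ m / 4)%:E)%E.
  move=> xi1.
  have mid x y : Q x -> Q y -> Q (2^-1 *: x + 2^-1 *: y).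
    by move=> Qx Qy; apply: convex_setP => //; lra.
  have := lebesgue_rV_section_le rho0 xi1 (some_perp_frameP xi1) mQ mid Qrho.
  rewrite -/(perp_embedding xi) => le6.
  have {le6}: ((6 * rho)%:E * lebesgue_rV R m (perp_embedding xi @^-1` E)
      <= ((6 * (C0 * v)) ^+ m.+1)%:E)%E.
    by apply: (le_trans le6); rewrite exprMn EFinM; exact: lee_wpmul2l.
  rewrite -lee_pdivlMl ?mulr_gt0// -EFinM => /le_trans; apply; rewrite lee_fin.
  rewrite ler_pdivrMl ?mulr_gt0// exprSr.
  (* One of the m+1 factors 6 C0 v is set aside and bounded using v <= sqrt n; this sqrt n cancels
     the one in [rho]. The gain 2^m from the remaining factors absorbs 4 C0 / r0. *)
  apply: (@le_trans _ _ ((b / 2) ^+ m * (6 * (C0 * Num.sqrt m.+1%:R)))).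
    apply: ler_pM; rewrite ?exprn_ge0 ?mulr_ge0 ?(ltW C0_gt0) ?(ltW v0)//.
      by rewrite lerXn2r ?nnegrE ?mulr_ge0 ?invr_ge0 ?(ltW C0_gt0) ?(ltW v0) ?(ltW b0)//;
        lra.
    by rewrite !ler_pM2l.
  have C2 : 4 * C0 / r0 <= 2 ^+ m.
    apply: (@le_trans _ _ (m.+1%:R)).
      rewrite (le_trans (ltW (archi_boundP _)))// ?ler_nat//.
      by rewrite divr_ge0 ?mulr_ge0 ?(ltW C0_gt0) ?(ltW r0_gt0).
    by rewrite -natrX ler_nat ltn_expl.
  rewrite ler_pdivrMr// in C2.
  have : (b / 2) ^+ m * 2 ^+ m <= Num.sqrt (pi * a) ^+ m.
    rewrite -exprMn divfK//.
    by rewrite lerXn2r ?nnegrE ?sqrtr_ge0 ?(ltW b0).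
  set X := (b / 2) ^+ m; set G := _ ^+ m => XG.
  have X0 : 0 <= X by rewrite exprn_ge0// divr_ge0// ltW.
  rewrite /rho; set s := Num.sqrt m.+1%:R in sn0 *.
  apply: (@le_trans _ _ (X * (6 * ((2 ^+ m * r0) / 4 * s)))).
    rewrite ler_wpM2l// ler_pM2l// ler_pM2r//; lra.
  rewrite (_ : X * _ = 6 * (r0 * s) * ((X * 2 ^+ m) / 4)); last by ring.
  by rewrite ler_wpM2l ?mulr_ge0 ?(ltW r0_gt0) ?(ltW sn0)// ler_wpM2r.
have [h [he ch hd hsupp hsec]] :=
  truncated_gauss_density (ltac:(by []) : (4 <= m)%N) a0 we cw mE w01 wD wE volE volsec.
exists h; split => //; last first.
  move=> xi /hsec; rewrite gE; congr ((_ : R)%:E <= _)%E.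
  by rewrite /b; field; rewrite ?gt_eqF// sqrtr_gt0 pi_gt0.
have R0 : 0 < A * v * Num.sqrt m.+1%:R by rewrite !mulr_gt0.
have RE : (A * v * Num.sqrt m.+1%:R) ^+ 2 = 4 * a * m.+1%:R.
  by rewrite exprMn sqr_sqrtr ?ler0n// /a /b; field.
rewrite dilate_l2ballE// RE setDE.
(* Removing only the interior of [D] leaves a closed set, so the inclusion passes from the
   nonvanishing set of [h] to its closure. *)
have clW : closed ([set x : 'rV[R]_m.+1 | dot x x <= 4 * a * m.+1%:R] `&` ~` D°).
  by apply: closedI; [exact: closed_dot_le|exact/open_closedC/open_interior].
rewrite [X in _ `<=` X](iffLR (closure_id _) clW); apply: closureS.
by move=> x /hsupp[xR nDx]; split => // /interior_subset.
Qed.
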